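(* Let $X$, $Y$ be graphs, let $\varphi\in\mathrm{O}(X,Y)$ be $\mathfrak{G}$-consistent for a subgroup $\mathfrak{G}\leq\mathrm{Aut}(X)$, and let $y\in V_Y$. (i) For each $C\in\mathcal{C}(X)_y$, $\mathcal{C}(X)_y=\{f(C):f\in\mathfrak{G}\}$. In particular, the components of $X$ belonging to $\mathcal{C}(X)_y$ are isomorphic to each other through a graph automorphism of $X$. (ii) $\mathrm{O}(X,Y)\subseteq\mathrm{CE}(X,Y)$. (iii) If $\varphi\in\mathrm{O}(X,Y)\cap\mathrm{Com}(X,Y)$, then $c(X)_y=\frac{|\varphi^{-1}(\varphi(V_C))|}{|V_C|}$ for all $C\in\mathcal{C}(X)_y$.
   Context: All graphs are finite, undirected, simple and reflexive: a graph $X=(V_X,E_X)$ has a finite nonempty vertex set $V_X$, and $E_X$ consists of all loops $\{x\}$ ($x\in V_X$) together with a (possibly empty) set of $2$-element subsets of $V_X$. A homomorphism $\varphi:X\to Y$ is a map $\varphi:V_X\to V_Y$ such that $\{x_1,x_2\}\in E_X$ implies $\{\varphi(x_1),\varphi(x_2)\}\in E_Y$ (a proper edge may be mapped to a loop). For a subgraph $\hat X$ of $X$ its image is $\varphi(\hat X)=(\varphi(V_{\hat X}),\varphi(E_{\hat X}))$. $\mathrm{Com}(X,Y)$ is the set of complete homomorphisms, i.e. those with $\varphi(V_X)=V_Y$ and $\varphi(E_X)=E_Y$. $\mathrm{O}(X,Y)$ is the set of orbit homomorphisms: those for which the nonempty fibres of $\varphi$ are exactly the orbits on $V_X$ of some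 subgroup $\mathfrak{G}\leq\mathrm{Aut}(X)$; for such a $\mathfrak{G}$ one says $\varphi$ is $\mathfrak{G}$-consistent. $\mathcal{C}(X)$ is the set of components (maximal connected subgraphs) of $X$. For $y\in V_Y$ and $C\in\mathcal{C}(X)$, $k_C(y)=|V_C\cap\varphi^{-1}(y)|$; $\mathcal{C}(X)_y=\{C\in\mathcal{C}(X):k_C(y)>0\}$ and $c(X)_y=|\mathcal{C}(X)_y|$. $\mathrm{CE}(X,Y)$ is the set of component equitable homomorphisms $\varphi: X\to Y$: those such that for every $y\in V_Y$ and all $C,\hat C\in\mathcal{C}(X)_y$ one has $k_C(y)=k_{\hat C}(y)$. *)

(* Defs.v *)
From HB Require Import structures.
From mathcomp Require Import all_boot all_order all_algebra all_fingroup.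

Set Implicit Arguments.
Unset Strict Implicit.
Unset Printing Implicit Defensive.

(** Finite, undirected, simple, reflexive graphs.  An edge is a set of vertices:
    a loop is a singleton [set x] (always present), a proper edge is a
    2-element set. *)
Record graph := Graph {
  vertex :> finType;
  edges : {set {set vertex}};
  graph_nonempty : 0 < #|vertex|;
  graph_loop : forall x : vertex, [set x] \in edges;
  graph_edge_card : forall e : {set vertex}, e \in edges -> 0 < #|e| <= 2 }.

Definition is_hom (X Y : graph) (f : X -> Y) : bool :=
  [forall x1, forall x2,
    ([set x1; x2] \in edges X) ==> ([set f x1; f x2] \in edges Y)].

Definition Hom (X Y : graph) : {set {ffun X -> Y}} := [set phi : {ffun X -> Y} | is_hom phi].

Definition graph_aut (X : graph) : {set {perm X}} :=
  [set f : {perm X} | is_hom f && is_hom (f^-1)%g].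

Lemma graph_aut_group_set (X : graph) : group_set (graph_aut X).
Proof.
have homP (f : {perm X}) :
    reflect (forall x y, [set x; y] \in edges X -> [set f x; f y] \in edges X)
            (is_hom f).
  apply: (iffP forallP) => [H x y | H x].
    by move/forallP: (H x) => /(_ y)/implyP.
  by apply/forallP => y; apply/implyP/H.
have homM (f g : {perm X}) : is_hom f -> is_hom g -> is_hom (f * g)%g.
  move=> /homP Hf /homP Hg; apply/homP => x y /Hf/Hg.
  by rewrite !permM.
apply/group_setP; split=> [|f g].
  by rewrite inE invg1 andbb; apply/homP => x y; rewrite !perm1.
rewrite !inE invMg => /andP[f1 f2] /andP[g1 g2].
by rewrite !homM.
Qed.

Canonical graph_aut_group (X : graph) := Group (graph_aut_group_set X).

(** A candidate subgraph is a pair (vertex set, edge set); it is a subgraph when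
    it is itself a graph (in particular nonempty and reflexive) and its edges
    are edges of X. *)
Notation presubgraph X := ({set (vertex X)} * {set {set (vertex X)}})%type.

Definition is_subgraph (X : graph) (C : presubgraph X) : bool :=
  [&& C.1 != set0, C.2 \subset edges X, C.2 \subset powerset C.1
    & [forall x in C.1, [set x] \in C.2]].

Definition is_connected (X : graph) (C : presubgraph X) : bool :=
  [forall x in C.1, forall y in C.1,
    connect [rel u v | [set u; v] \in C.2] x y].

Definition is_component (X : graph) (C : presubgraph X) : bool :=
  [&& is_subgraph C, is_connected C
    & [forall D : presubgraph X,
        [&& is_subgraph D, is_connected D, C.1 \subset D.1 & C.2 \subset D.2]
          ==> (D == C)]].

Definition components (X : graph) : {set presubgraph X} :=
  [set C | is_component C].

Definition edge_image (X Y : graph) (f : X -> Y) (E : {set {set X}}) :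
  {set {set Y}} := [set f @: e | e : {set X} in E].

Definition image_sub (X Y : graph) (f : X -> Y) (C : presubgraph X) :
  presubgraph Y := (f @: C.1, edge_image f C.2).

(** f restricts to a graph isomorphism from C onto D. *)
Definition sub_iso (X : graph) (f : {perm X}) (C D : presubgraph X) : Prop :=
  f @: C.1 = D.1 /\
  {in C.1 &, forall x1 x2, ([set x1; x2] \in C.2) = ([set f x1; f x2] \in D.2)}.

Definition fibre (X Y : graph) (phi : {ffun X -> Y}) (y : Y) : {set X} :=
  phi @^-1: [set y].

Definition Com (X Y : graph) : {set {ffun X -> Y}} :=
  [set phi : {ffun X -> Y} in Hom X Y | (phi @: [set: X] == [set: Y]) &&
                        (edge_image phi (edges X) == edges Y)].

(** The nonempty fibres of phi are exactly the orbits of G on the vertices. *)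
Definition consistent (X Y : graph) (G : {group {perm X}})
    (phi : {ffun X -> Y}) : bool :=
  [set fibre phi y | y : Y & fibre phi y != set0] == orbit 'P G @: [set: X].

Definition Orb (X Y : graph) : {set {ffun X -> Y}} :=
  [set phi : {ffun X -> Y} in Hom X Y |
    [exists G : {group {perm X}}, (G \subset graph_aut X) && consistent G phi]].

Definition k_comp (X Y : graph) (phi : {ffun X -> Y}) (C : presubgraph X)
    (y : Y) : nat := #|C.1 :&: fibre phi y|.

Definition components_at (X Y : graph) (phi : {ffun X -> Y}) (y : Y) :
  {set presubgraph X} := [set C in components X | 0 < k_comp phi C y].

Definition c_at (X Y : graph) (phi : {ffun X -> Y}) (y : Y) : nat :=
  #|components_at phi y|.

Definition CE (X Y : graph) : {set {ffun X -> Y}} :=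
  [set phi : {ffun X -> Y} in Hom X Y |
    [forall y, forall C in components_at phi y, forall D in components_at phi y,
      k_comp phi C y == k_comp phi D y]].

(* Main.v *)
(** Two vertices lie in the same fibre of phi exactly when some g in G carries
    one to the other.  An automorphism sends components to components, and two
    components sharing a vertex coincide, so if C and D both meet the fibre of
    y, an element of G carrying a vertex of C to a vertex of D over y maps C
    onto D.  Hence the G-translates of C are the components over y, they all
    have the same trace size on each fibre, and they partition
    phi^-1(phi(V_C)), which gives the counting formula. *)
Require Import Defs.
From HB Require Import structures.
From mathcomp Require Import all_boot all_order all_algebra all_fingroup.
Import GRing.Theory.
Local Open Scope ring_scope.

Set Implicit Arguments.
Unset Strict Implicit.
Unset Printing Implicit Defensive.

(** * Images of edges, subgraphs and components *)

Lemma hom_edge (X Y : graph) (f : X -> Y) (x1 x2 : X) :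
  is_hom f -> [set x1; x2] \in edges X -> [set f x1; f x2] \in edges Y.
Proof. by move=> /forallP/(_ x1)/forallP/(_ x2)/implyP; apply. Qed.

(** Loops are covered by taking equal endpoints, so every edge gets the pair form in which [is_hom]
    is stated. *)
Lemma edge_pair (X : graph) (e : {set X}) :
  e \in edges X -> exists x1 x2, e = [set x1; x2].
Proof.
move=> /graph_edge_card /andP[e_gt0]; rewrite leq_eqVlt => /orP[/cards2P|e_lt2].
  by case=> x1 [x2 [_ ->]]; exists x1, x2.
have /cards1P[x ->]: #|e| == 1%N by rewrite eqn_leq e_gt0 -ltnS e_lt2.
by exists x, x; rewrite setUid.
Qed.

Lemma hom_imset_edge (X Y : graph) (f : X -> Y) (e : {set X}) :
  is_hom f -> e \in edges X -> f @: e \in edges Y.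
Proof.
move=> fhom eX; have [x1 [x2 def_e]] := edge_pair eX.
by rewrite def_e imsetU1 imset_set1 hom_edge // -def_e.
Qed.

Lemma image_sub_subgraph (X Y : graph) (f : X -> Y) (C : presubgraph X) :
  is_hom f -> is_subgraph C -> is_subgraph (image_sub f C).
Proof.
move=> fhom /and4P[C0 CX /subsetP CC /forall_inP Cl]; apply/and4P; split=> /=.
- by rewrite imset_eq0.
- by apply/subsetP=> _ /imsetP[e /(subsetP CX) eX ->]; apply: hom_imset_edge.
- apply/subsetP=> _ /imsetP[e /CC eC ->].
  by move: eC; rewrite !powersetE; apply: imsetS.
- apply/forall_inP=> _ /imsetP[x /Cl xC ->].
  by rewrite -imset_set1; apply: imset_f.
Qed.

Lemma image_sub_connected (X Y : graph) (f : X -> Y) (C : presubgraph X) :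
  is_connected C -> is_connected (image_sub f C).
Proof.
move=> Cc; apply/forall_inP=> _ /imsetP[x xC ->].
apply/forall_inP=> _ /imsetP[y yC ->].
move/forall_inP: Cc => /(_ x xC)/forall_inP/(_ y yC)/connectP[p xp ->] {y yC}.
elim: p x {xC} xp => [|z p IHp] x //= /andP[xz zp].
apply: connect_trans (IHp z zp); apply: connect1 => /=.
by apply/imsetP; exists [set x; z] => //; rewrite imsetU1 imset_set1.
Qed.

Lemma image_subK (X Y : graph) (f : X -> Y) (g : Y -> X) :
  cancel f g -> cancel (@image_sub X Y f) (image_sub g).
Proof.
move=> fK [V E]; rewrite /image_sub /edge_image /=.
have sK : cancel (fun A : {set X} => f @: A) (fun A : {set Y} => g @: A).
  by move=> A; rewrite -imset_comp -[RHS]imset_id; apply: eq_imset => x /=.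
by rewrite sK -imset_comp -[in RHS](imset_id E); congr pair;
  apply: eq_imset => e /=; rewrite sK.
Qed.

(** Maximality is pulled back along [f]: a connected subgraph [D] above the image of [C] has a
    preimage above [C], which must be [C] itself. That this preimage is a subgraph uses that the
    inverse of [f] is a homomorphism too. *)
Lemma image_sub_component (X : graph) (f : {perm X}) (C : presubgraph X) :
  f \in graph_aut X -> C \in components X -> image_sub f C \in components X.
Proof.
rewrite !inE => /andP[fhom fVhom] /and3P[Cs Cc /forallP Cmax].
apply/and3P; split; [exact: image_sub_subgraph|exact: image_sub_connected|].
apply/forallP=> D; apply/implyP=> /and4P[Ds Dc CD1 CD2].
have fVK := image_subK (permKV f); have fK := image_subK (permK f).
(* Comparing after applying the inverse of [f] turns the goal into an instance of the maximality of
   [C]. *)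
rewrite -(inj_eq (can_inj fVK)) fK.
apply: (implyP (Cmax _)); rewrite image_sub_subgraph ?image_sub_connected //=.
by rewrite -(fK C) /= !imsetS.
Qed.

(** * Unions of overlapping connected subgraphs *)

Lemma setU_subgraph (X : graph) (C D : presubgraph X) :
  is_subgraph C -> is_subgraph D -> is_subgraph (C.1 :|: D.1, C.2 :|: D.2).
Proof.
move=> /and4P[C0 CX CC /forall_inP Cl] /and4P[_ DX DD /forall_inP Dl].
apply/and4P; split=> /=.
- by have [x xC] := set0Pn _ C0; apply/set0Pn; exists x; rewrite inE xC.
- by rewrite subUset CX.
- rewrite subUset (subset_trans CC) ?(subset_trans DD) //.
    by rewrite powersetS subsetUr.
  by rewrite powersetS subsetUl.
- apply/forall_inP=> x; rewrite !inE => /orP[/Cl ->|/Dl ->] //.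
  by rewrite orbT.
Qed.

(** Every vertex of the union is reachable from the shared vertex [x], and adjacency is symmetric,
    so any two vertices are joined through [x]. *)
Lemma setU_connected (X : graph) (C D : presubgraph X) (x : X) :
    x \in C.1 -> x \in D.1 -> is_connected C -> is_connected D ->
  is_connected (C.1 :|: D.1, C.2 :|: D.2).
Proof.
move=> xC xD Cc Dc.
pose e := [rel u v : X | [set u; v] \in C.2 :|: D.2].
have xconn z : z \in C.1 :|: D.1 -> connect e x z.
  have sub_e (E : {set {set X}}) : E \subset C.2 :|: D.2 ->
      connect [rel u v | [set u; v] \in E] x z -> connect e x z.
    move=> sE; apply: connect_sub => u v /= uv; apply: connect1.
    exact: (subsetP sE).
  rewrite inE => /orP[zC|zD].
    apply: (sub_e C.2); first exact: subsetUl.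
    by move/forall_inP: Cc => /(_ x xC)/forall_inP; apply.
  apply: (sub_e D.2); first exact: subsetUr.
  by move/forall_inP: Dc => /(_ x xD)/forall_inP; apply.
have esym : connect_sym e by apply: sym_connect_sym => u v /=; rewrite setUC.
apply/forall_inP=> u /xconn xu; apply/forall_inP=> v /xconn.
by apply: connect_trans; rewrite esym.
Qed.

(** The union of [C] and [D] is a connected subgraph above both, so by maximality each of them
    equals it. *)
Lemma component_eq (X : graph) (C D : presubgraph X) (x : X) :
    C \in components X -> D \in components X -> x \in C.1 -> x \in D.1 ->
  C = D.
Proof.
rewrite !inE => /and3P[Cs Cc /forallP Cmax] /and3P[Ds Dc /forallP Dmax] xC xD.
pose U : presubgraph X := (C.1 :|: D.1, C.2 :|: D.2).
have Us : is_subgraph U by apply: setU_subgraph.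
have Uc : is_connected U by apply: setU_connected xC xD _ _.
have /eqP <- : U == C by apply: (implyP (Cmax U)); rewrite Us Uc !subsetUl.
by apply/eqP/(implyP (Dmax U)); rewrite Us Uc !subsetUr.
Qed.

(** Pointwise form of consistency, which is defined as an equality between two families of sets. *)
Lemma consistentP (X Y : graph) (phi : {ffun X -> Y}) (G : {group {perm X}})
    (x z : X) :
  consistent G phi ->
  reflect (exists2 g : {perm X}, g \in G & z = g x) (phi z == phi x).
Proof.
move=> /eqP fibE.
have -> : (phi z == phi x) = (z \in orbit 'P G x).
  have -> : (phi z == phi x) = (z \in fibre phi (phi x)) by rewrite !inE.
  have xfib : x \in fibre phi (phi x) by rewrite !inE.
  have : fibre phi (phi x) \in [set fibre phi y | y : Y & fibre phi y != set0].
    by apply: imset_f; rewrite inE; apply/set0Pn; exists x.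
  (* The fibre through [x] is the orbit of some [t]; since it contains [x], it is also the orbit of
     [x]. *)
  rewrite fibE => /imsetP[t _ fib_t].
  by move: xfib; rewrite fib_t => /orbit_eqP->.
by apply: (iffP orbitP) => [[g gG <-]|[g gG ->]]; exists g.
Qed.

Lemma components_atP (X Y : graph) (phi : {ffun X -> Y}) (y : Y)
    (C : presubgraph X) :
  reflect (C \in components X /\ exists2 x, x \in C.1 & phi x = y)
          (C \in components_at phi y).
Proof.
have -> : (C \in components_at phi y) =
    (C \in components X) && (0 < k_comp phi C y)%N by rewrite inE.
apply: (iffP andP) => -[Ccomp].
  case/card_gt0P=> x /setIP[xC x_fib]; split=> //; exists x => //.
  by apply/eqP; rewrite !inE in x_fib.
move=> [x xC xy]; split=> //; apply/card_gt0P; exists x.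
by rewrite !inE xC xy eqxx.
Qed.

(** * Translates of a component under a consistent group *)

Section Consistent.

Variables (X Y : graph) (phi : {ffun X -> Y}) (G : {group {perm X}}).
Hypotheses (hG : G \subset graph_aut X) (hGphi : consistent G phi).

Lemma consistent_fix (g : {perm X}) (x : X) : g \in G -> phi (g x) = phi x.
Proof. by move=> gG; apply/eqP/(consistentP _ _ hGphi); exists g. Qed.

Lemma component_translate (C D : presubgraph X) (x z : X) :
    C \in components X -> D \in components X ->
    x \in C.1 -> z \in D.1 -> phi z = phi x ->
  exists2 g : {perm X}, g \in G & D = image_sub g C.
Proof.
move=> Cc Dc xC zD /eqP/(consistentP _ _ hGphi)[g gG zE]; exists g => //.
apply: (@component_eq _ _ _ z) => //; last by rewrite zE imset_f.
by apply: image_sub_component => //; apply: (subsetP hG).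
Qed.

Lemma components_at_translate (y : Y) (C D : presubgraph X) :
    C \in components_at phi y -> D \in components_at phi y ->
  exists2 g : {perm X}, g \in G & D = image_sub g C.
Proof.
move=> /components_atP[Cc [x xC xy]] /components_atP[Dc [z zD zy]].
by apply: (@component_translate _ _ x z) => //; rewrite zy.
Qed.

Lemma translate_components_at (y : Y) (C : presubgraph X) (g : {perm X}) :
    g \in G -> C \in components_at phi y ->
  image_sub g C \in components_at phi y.
Proof.
move=> gG /components_atP[Cc [x xC xy]]; apply/components_atP; split.
  by apply: image_sub_component => //; apply: (subsetP hG).
by exists (g x); rewrite ?imset_f ?consistent_fix.
Qed.

Lemma components_at_orbit (y : Y) (C : presubgraph X) :
    C \in components_at phi y ->
  components_at phi y = [set image_sub f C | f : {perm X} in G].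
Proof.
move=> Cy; apply/setP=> D; apply/idP/imsetP => [Dy|[g gG ->]].
  exact: components_at_translate Cy Dy.
exact: translate_components_at.
Qed.

(** Elements of [G] preserve each fibre, so [g] maps the trace of [C] bijectively onto the trace of
    its translate. *)
Lemma k_comp_translate (g : {perm X}) (C : presubgraph X) (y : Y) :
  g \in G -> k_comp phi (image_sub g C) y = k_comp phi C y.
Proof.
move=> gG; rewrite /k_comp -[RHS](card_imset _ (@perm_inj _ g)).
apply: eq_card => z; rewrite -(permKV g z) (mem_imset _ _ perm_inj).
by rewrite !inE /= (mem_imset _ _ perm_inj) consistent_fix.
Qed.

Lemma preim_component_partition (y : Y) (C : presubgraph X) :
    C \in components_at phi y ->
  partition [set D.1 | D in components_at phi y] (phi @^-1: (phi @: C.1)).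
Proof.
move=> Cy; have /components_atP[Cc _] := Cy; apply/and3P; split.
- apply/eqP/setP=> z; rewrite cover_imset; apply/bigcupP/idP.
    move=> [D Dy]; have [g gG ->] := components_at_translate Cy Dy.
    by case/imsetP=> x xC ->; rewrite inE consistent_fix // imset_f.
  (* A vertex with the same image as some [x] in [C] is [g x] for some [g] in [G], hence lies in a
     translate of [C]. *)
  rewrite inE => /imsetP[x xC /eqP/(consistentP _ _ hGphi)[g gG ->]].
  by exists (image_sub g C); rewrite ?translate_components_at ?imset_f.
- apply/trivIsetP=> _ _ /imsetP[D Dy ->] /imsetP[E Ey ->] neqDE.
  apply/pred0Pn => -[x /andP[/= xD xE]]; case/eqP: neqDE.
  have [/components_atP[Dc _] /components_atP[Ec _]] := (Dy, Ey).
  by rewrite (component_eq Dc Ec xD xE).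
- apply/imsetP=> -[D /components_atP[_ [x xD _]] D0].
  by rewrite -D0 inE in xD.
Qed.

Lemma card_preim_component (y : Y) (C : presubgraph X) :
    C \in components_at phi y ->
  #|phi @^-1: (phi @: C.1)| = (c_at phi y * #|C.1|)%N.
Proof.
move=> Cy.
rewrite (card_uniform_partition _ (preim_component_partition Cy)
           (n := #|C.1|)).
  (* The blocks are vertex sets, whereas [c_at] counts components; a component is determined by its
     vertex set, since that set is nonempty. *)
  congr (_ * _)%N; apply: card_in_imset => D E.
  move=> /components_atP[Dc [x xD _]] /components_atP[Ec _] DE.
  by apply: (@component_eq _ _ _ x) => //; rewrite -DE.
move=> _ /imsetP[D Dy ->].
have [g _ ->] := components_at_translate Cy Dy.
exact: card_imset perm_inj.
Qed.

End Consistent.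

(** Edges are reflected as well as preserved because taking images under a permutation is injective
    on vertex sets. *)
Lemma image_sub_iso (X : graph) (f : {perm X}) (C : presubgraph X) :
  sub_iso f C (image_sub f C).
Proof.
split=> // x1 x2 _ _; rewrite -(imset_set1 f x2) -imsetU1.
by rewrite (mem_imset _ _ (imset_inj perm_inj)).
Qed.

Lemma Orb_sub_CE (X Y : graph) : Orb X Y \subset CE X Y.
Proof.
apply/subsetP=> phi; rewrite !inE => /andP[-> /existsP[G /andP[hG hGphi]]] /=.
apply/forallP=> y; apply/forall_inP=> C Cy; apply/forall_inP=> D Dy.
have [g gG ->] := components_at_translate hG hGphi Cy Dy.
by rewrite (k_comp_translate hGphi).
Qed.

Theorem proposition6p9 (X Y : graph) (phi : {ffun X -> Y})
  (G : {group {perm X}}) (y : Y)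
  (hphi : phi \in Orb X Y) (hG : G \subset graph_aut X) (hGphi : consistent G phi) :
  [/\
      (forall C, C \in components_at phi y ->
         components_at phi y = [set image_sub f C | f : {perm X} in G]) /\
      (forall C D, C \in components_at phi y -> D \in components_at phi y ->
         exists2 f : {perm X}, f \in graph_aut X & sub_iso f C D),
      Orb X Y \subset CE X Y &
      phi \in Orb X Y :&: Com X Y ->
      forall C, C \in components_at phi y ->
        (c_at phi y)%:R = #|phi @^-1: (phi @: C.1)|%:R / #|C.1|%:R :> rat].
Proof.
split; [split=> [C | C D Cy Dy] | exact: Orb_sub_CE | move=> _ C Cy].
- exact: components_at_orbit.
- have [g gG ->] := components_at_translate hG hGphi Cy Dy.
  by exists g; [apply: (subsetP hG) | apply: image_sub_iso].
- rewrite (card_preim_component hG hGphi Cy) natrM mulfK //.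
  (* The denominator is nonzero: [C] has a vertex over [y]. *)
  have /components_atP[_ [x xC _]] := Cy.
  by rewrite Num.Theory.pnatr_eq0 -lt0n; apply/card_gt0P; exists x.
Qed.
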